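(* Let $\mathcal A$ and $\mathcal B$ be two Tauberian BSE-algebras satisfying condition $(M)$ which have $1$-bounded approximate identities. Then a linear map $T:\mathcal A\to\mathcal B$ is a bijective separating map if and only if $T=T_2\circ T_1$, where $T_1:\mathcal A\to\mathcal B$ is an algebra isomorphism and $T_2\in M(\mathcal B)$.
   Context: For a commutative Banach algebra $\mathcal{A}$ (over $\mathbb{C}$), $\Omega_{\mathcal{A}}$ is its maximal ideal (character) space with the Gelfand topology, $\widehat{a}$ is the Gelfand transform of $a$, and $\operatorname{supp}(\widehat a)$ is the closure of $\{x\in\Omega_{\mathcal A}:\widehat a(x)\ne0\}$. $\mathcal{A}$ is semisimple if $\bigcap_{x\in\Omega_{\mathcal A}}\ker x=\{0\}$. $\mathcal{A}$ is regular if for every $x\in\Omega_{\mathcal A}$ and open neighbourhood $U$ of $x$ there is $a\in\mathcal A$ with $\widehat a(x)=1$ and $\widehat a=0$ on $\Omega_{\mathcal A}\setminus U$. $\mathcal A_c$ is the set of $a\in\mathcal A$ with $\operatorname{supp}(\widehat a)$ compact. A Tauberian algebra is a semisimple commutative Banach algebra $\mathcal A$ in which $\mathcal A_c$ is dense. Condition $(M)$: $\mathcal A$ is regular and for each $x\in\Omega_{\mathcal A}$, each $a\in\mathcal A$ with $\widehat a(x)=0$, and each neighbourhood $U$ of $x$, $\inf\{\|ba\|_{\mathcal A}: b\in\mathcal A,\ \widehat b|_V\equiv1 \text{ for some neighbourhood } V \text{ of } x,\ \operatorname{supp}(\widehat b)\subseteq U\}=0$. A linear map $T:\mathcal A\to\mathcal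 B$ is separating if $a_1a_2=0$ implies $Ta_1\,Ta_2=0$ for all $a_1,a_2\in\mathcal A$. A $1$-bounded approximate identity is an approximate identity $(e_\alpha)$ with $\|e_\alpha\|\le1$ for all $\alpha$. A multiplier of $\mathcal B$ is a bounded linear operator $S:\mathcal B\to\mathcal B$ with $a(Sb)=(Sa)b$ for all $a,b\in\mathcal B$; $M(\mathcal B)$ is the commutative Banach algebra of all multipliers. For semisimple $\mathcal B$, each $S\in M(\mathcal B)$ is identified with the bounded continuous function $\phi$ on $\Omega_{\mathcal B}$ with $\widehat{Sb}=\phi\,\widehat b$ for all $b\in\mathcal B$. A function $\varphi:\Omega_{\mathcal B}\to\mathbb C$ satisfies the BSE-condition if there is $C>0$ such that for all finite $\{y_1,\dots,y_n\}\subset\Omega_{\mathcal B}$ and $\{\alpha_1,\dots,\alpha_n\}\subset\mathbb C$, $|\sum_i\alpha_i\varphi(y_i)|\le C\|\sum_i\alpha_iy_i\|_{\mathcal B^*}$. $\mathcal B$ is a BSE-algebra if the set of continuous functions on $\Omega_{\mathcal B}$ satisfying the BSE-condition equals $M(\mathcal B)$ (under the identification above).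
   Formalization: The multiplier T_2 is additionally required to be bijective, since as written the ''if'' direction fails for T_2 = 0 (T = 0 is not bijective when B is nonzero); the ''only if'' direction yields a bijective T_2. *)

(* Defs.v *)
From HB Require Import structures.
From mathcomp Require Import all_boot all_order all_algebra.
From mathcomp Require Import all_classical all_reals all_analysis.
From mathcomp Require Import complex.

Set Implicit Arguments.
Unset Strict Implicit.
Unset Printing Implicit Defensive.

Import Order.TTheory GRing.Theory Num.Theory.
Import numFieldNormedType.Exports.

Local Open Scope classical_set_scope.
Local Open Scope ring_scope.
Local Open Scope complex_scope.

Reserved Notation "a ** b" (at level 40, left associativity).

(* Banach algebras need not have a unit, so the product is a separate operation
   and not the one of a MathComp ring, which always has a 1. *)
HB.mixin Record CompleteNormedModule_isCommBanachAlgebra (K : numFieldType) A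
    & CompleteNormedModule K A := {
  bmul : A -> A -> A ;
  bmulA : associative bmul ;
  bmulC : commutative bmul ;
  bmulDl : forall a b c : A, bmul (a + b) c = bmul a c + bmul b c ;
  bmulZl : forall (k : K) (a b : A), bmul (k *: a) b = k *: bmul a b ;
  ler_norm_bmul : forall a b : A, `|bmul a b| <= `|a| * `|b|
}.

#[short(type="commBanachAlgType")]
HB.structure Definition CommBanachAlgebra (K : numFieldType) :=
  {A of CompleteNormedModule K A
      & CompleteNormedModule_isCommBanachAlgebra K A}.

Notation "a ** b" := (bmul a b) : ring_scope.

Section Gelfand.
Variables (R : realType) (A : commBanachAlgType R[i]).

(* Continuity is not required: nonzero multiplicative functionals on a Banach
   algebra are automatically continuous. *)
Record character := Character {
  char_fun :> {linear A -> R[i]^o} ;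
  char_mul : forall a b : A, char_fun (a ** b) = char_fun a * char_fun b ;
  char_neq0 : exists a : A, char_fun a != 0
}.

HB.instance Definition _ := gen_eqMixin character.
HB.instance Definition _ := gen_choiceMixin character.

(* The Gelfand topology, i.e. pointwise convergence on A. *)
HB.instance Definition _ := Topological.copy character
  (initial_topology (fun x : character => (x : A -> R[i]^o) : {ptws A -> R[i]^o})).

Definition gelfand (a : A) : character -> R[i]^o := fun x => x a.

Definition gelfand_supp (a : A) : set character :=
  closure [set x | gelfand a x != 0].

Definition semisimple_alg : Prop :=
  \bigcap_(x in [set: character]) [set a : A | x a = 0] = [set 0].

Definition regular_alg : Prop :=
  forall (x : character) (U : set character), open U -> U x ->
    exists a : A, gelfand a x = 1 /\ forall y, ~ U y -> gelfand a y = 0.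

Definition compact_supp : set A := [set a | compact (gelfand_supp a)].

Definition tauberian : Prop := semisimple_alg /\ dense compact_supp.

(* The infimum is taken in the extended reals, so that it is +oo, and not 0,
   on an empty set. The norm takes its values in R[i], hence the Re. *)
Definition condition_M : Prop :=
  regular_alg /\
  forall (x : character) (a : A) (U : set character),
    gelfand a x = 0 -> nbhs x U ->
    ereal_inf [set (complex.Re `|b ** a|)%:E | b in
      [set b : A | (exists2 V, nbhs x V & forall y, V y -> gelfand b y = 1) /\
                   gelfand_supp b `<=` U]] = 0%E.

Definition directed (I : Type) (le : I -> I -> Prop) : Prop :=
  [/\ inhabited I, (forall i, le i i),
      (forall i j k, le i j -> le j k -> le i k) &
      (forall i j, exists k, le i k /\ le j k)].

Definition has_1_bounded_approx_id : Prop :=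
  exists (I : Type) (le : I -> I -> Prop) (e : I -> A),
    [/\ directed le, (forall i, `|e i| <= 1) &
        forall a : A,
          e i ** a @[i --> filter_from [set: I] (fun i => [set j | le i j])] --> a].

Definition bounded_op (S : A -> A) : Prop :=
  exists M : R, forall b, `|S b| <= M%:C * `|b|.

Definition is_multiplier (S : {linear A -> A}) : Prop :=
  bounded_op S /\ forall a b : A, a ** S b = S a ** b.

(* M(A) as a set of functions on the character space. *)
Definition multiplier_functions : set (character -> R[i]^o) :=
  [set phi : character -> R[i]^o |
   [/\ continuous phi, (exists M : R, forall x, `|phi x| <= M%:C) &
     exists2 S : {linear A -> A}, is_multiplier S &
       forall b x, gelfand (S b) x = phi x * gelfand b x]].

Definition dual_norm (f : A -> R[i]) : \bar R :=
  ereal_sup [set (complex.Re `|f b|)%:E | b in [set b : A | `|b| <= 1]].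

Definition BSE_condition (phi : character -> R[i]^o) : Prop :=
  exists2 C : R, 0 < C &
    forall (n : nat) (y : 'I_n -> character) (alpha : 'I_n -> R[i]),
      ((complex.Re `|\sum_(i < n) alpha i * phi (y i)|)%:E <=
       C%:E * dual_norm (fun b => \sum_(i < n) alpha i * y i b)%R)%E.

Definition BSE_algebra : Prop :=
  [set phi : character -> R[i]^o | continuous phi /\ BSE_condition phi] = multiplier_functions.

End Gelfand.

Section Maps.
Variables (R : realType) (A B : commBanachAlgType R[i]).

Definition separating (T : A -> B) : Prop :=
  forall a1 a2 : A, a1 ** a2 = 0 -> T a1 ** T a2 = 0.

Definition algebra_isomorphism (T : {linear A -> B}) : Prop :=
  bijective T /\ forall a b : A, T (a ** b) = T a ** T b.

End Maps.

(* Main.v *)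
Require Import Defs.
From HB Require Import structures.
From mathcomp Require Import all_boot all_order all_algebra.
From mathcomp Require Import all_classical all_reals all_analysis.
From mathcomp Require Import complex.
From mathcomp Require Import ring lra.
Set Implicit Arguments.
Unset Strict Implicit.
Unset Printing Implicit Defensive.
Import Order.TTheory GRing.Theory Num.Theory.
Import numFieldNormedType.Exports.
Local Open Scope classical_set_scope.
Local Open Scope ring_scope.
Local Open Scope complex_scope.

(** Up to a weight, a separating bijection [T] is composition with a map between
    the character spaces. For a character [y] of [B], the functional [a |-> y (T a)]
    sends one of [a1], [a2] to 0 whenever [a1 ** a2 = 0]. The local units that
    condition (M) provides allow partitions of unity on compact sets, and they
    show that such a functional, when nonzero on some element with compact
    support, depends only on the germ of the Gelfand transform at one point [x]
    ([exists_support]).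

    A germ is not yet a value, because [T] is not assumed to be continuous. A
    gliding hump built with the small elements of condition (M) shows that the
    points [x] at which some such functional is a multiple [w * x a] of the value
    are dense ([weighted_image_dense]). As [A] is semisimple, this density makes
    the graph of [T] closed, so [T] is bounded ([separating_bounded]). Then all
    functionals are of this form: [y (T a) = w y * h y a] with [w y != 0]
    ([separating_weighted_composition]). Density also shows that the inverse of
    [T] is separating ([separating_inverse]), hence it is bounded and has the
    same form, with a map [k] and a weight [v] satisfying [w y * v (h y) = 1].

    A bounded approximate identity tends to 1 at every character, so [w] is a
    limit of transforms of bounded elements and satisfies the BSE condition
    ([weight_BSE]); it is continuous, hence a multiplier of [B], and likewise [v]
    is a multiplier of [A] ([weight_multiplier]). Multiplying by [v] before
    applying [T] removes the weight: the result [T1] composes transforms with [h],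
    so it is an algebra isomorphism, and [T] is [T1] followed by multiplication
    by [w].

    Conversely a multiplier acts at each character as multiplication by a number,
    so it preserves the vanishing of products in a semisimple algebra. *)

(** * Norms and limits with real values *)

Section RealNorm.
Variable R : realType.
Implicit Types V W : normedModType R[i].

(** The norm of a module over [R[i]] takes its values in [R[i]]; its real part
    loses nothing and lives in an archimedean ordered field. *)
Definition rnorm V (v : V) : R := complex.Re `|v|.

Lemma rnormE V (v : V) : `|v| = (rnorm v)%:C.
Proof. by rewrite RRe_real // normr_real. Qed.

Lemma rnorm_leC V (v : V) (M : R) : (rnorm v <= M) = (`|v| <= M%:C).
Proof. by rewrite rnormE lecR. Qed.

Lemma rnorm_ltC V (v : V) (M : R) : (rnorm v < M) = (`|v| < M%:C).
Proof. by rewrite rnormE ltcR. Qed.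

Lemma rnorm_ge0 V (v : V) : 0 <= rnorm v.
Proof. by rewrite -ler0c -rnormE. Qed.

Lemma rnorm0 V : rnorm (0 : V) = 0.
Proof. by rewrite /rnorm normr0. Qed.

Lemma rnorm_eq0 V (v : V) : (rnorm v == 0) = (v == 0).
Proof. by rewrite -[RHS]normr_eq0 rnormE eq_complex /= eqxx andbT. Qed.

Lemma rnorm_gt0 V (v : V) : v != 0 -> 0 < rnorm v.
Proof. by move=> v0; rewrite lt_neqAle rnorm_ge0 eq_sym rnorm_eq0 v0. Qed.

Lemma rnormN V (v : V) : rnorm (- v) = rnorm v.
Proof. by rewrite /rnorm normrN. Qed.

Lemma rnormB V (v w : V) : rnorm (v - w) = rnorm (w - v).
Proof. by rewrite /rnorm distrC. Qed.

Lemma rnormD V (v w : V) : rnorm (v + w) <= rnorm v + rnorm w.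
Proof.
by rewrite -lecR rmorphD /= -!rnormE ler_normD.
Qed.

Lemma rnormBD V (u v w : V) : rnorm (u - w) <= rnorm (u - v) + rnorm (v - w).
Proof. by rewrite -[u - w](subrKA v) rnormD. Qed.

Lemma rnormZ V (k : R[i]) (v : V) : rnorm (k *: v) = rnorm (k : R[i]^o) * rnorm v.
Proof.
apply: complexI; rewrite rmorphM /= -!rnormE normrZ //.
Qed.

Lemma rnormM (k l : R[i]) :
  rnorm (k * l : R[i]^o) = rnorm (k : R[i]^o) * rnorm (l : R[i]^o).
Proof. exact: (@rnormZ R[i]^o k l). Qed.

Lemma rnorm_real (r : R) : rnorm (r%:C : R[i]^o) = `|r|.
Proof. by rewrite /rnorm normc_def /= expr0n /= addr0 sqrtr_sqr. Qed.

Lemma rnorm_small V (v : V) : (forall e : R, 0 < e -> rnorm v <= e) -> v = 0.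
Proof.
move=> h; apply/eqP; rewrite -rnorm_eq0 eq_le rnorm_ge0 andbT.
by apply/ler_addgt0Pl => e e0; rewrite addr0; apply: h.
Qed.

Lemma rnorm_bmul (A : commBanachAlgType R[i]) (a b : A) :
  rnorm (a ** b) <= rnorm a * rnorm b.
Proof. by rewrite -lecR rmorphM /= -!rnormE ler_norm_bmul. Qed.

Lemma nbhs_rnorm V (v : V) (P : set V) :
  nbhs v P <-> exists2 e : R, 0 < e & forall w, rnorm (w - v) < e -> P w.
Proof.
split=> [/nbhs_ballP[e /= e0 eP]|[e e0 eP]].
  have er : e = (complex.Re e)%:C by rewrite RRe_real // gtr0_real.
  exists (complex.Re e); first by rewrite -ltcR -er.
  move=> w; rewrite rnormB rnorm_ltC -er => vw; apply: eP.
  by rewrite -ball_normE.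
apply/nbhs_ballP; exists e%:C; first by rewrite /= ltcR.
by move=> w; rewrite -ball_normE /= -rnorm_ltC rnormB; apply: eP.
Qed.

Lemma geometric_lt (C e : R) : 0 < e -> exists N, C / 2 ^+ N < e.
Proof.
move=> e0; pose N := (Num.truncn (C / e)).+1; exists N.
have : C / e < 2 ^+ N.
  apply: lt_le_trans (truncnS_gt _) _.
  by rewrite -natrX ler_nat ltnW // ltn_expl.
by rewrite !ltr_pdivrMr ?exprn_gt0 // [X in _ -> _ < X]mulrC.
Qed.

(** The only form in which completeness is used: with an explicit rate, so that
    the limit can be compared with every term of the sequence. *)
Lemma complete_geometric (V : completeNormedModType R[i]) (u : nat -> V) (C : R) :
  (forall n, rnorm (u n.+1 - u n) <= C / 2 ^+ n) ->
  exists l : V, forall n, rnorm (l - u n) <= C * 2 / 2 ^+ n.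
Proof.
move=> hu.
have C0 : 0 <= C by have := le_trans (rnorm_ge0 _) (hu 0%N); rewrite expr0 divr1.
have p0 n : 0 < 2 ^+ n :> R by apply: exprn_gt0.
have step n k : rnorm (u (n + k)%N - u n) <= C * 2 / 2 ^+ n - C * 2 / 2 ^+ (n + k).
  elim: k => [|k IH]; first by rewrite addn0 !subrr rnorm0.
  apply: le_trans (rnormBD _ (u (n + k)%N) _) _.
  rewrite addnS; apply: le_trans (lerD (hu _) IH) _.
  have -> : C * 2 / 2 ^+ (n + k).+1 = C / 2 ^+ (n + k).
    by rewrite exprS invfM; field; apply: lt0r_neq0.
  lra.
have step' n k : rnorm (u (n + k)%N - u n) <= C * 2 / 2 ^+ n.
  by apply: le_trans (step n k) _; rewrite gerBl divr_ge0 ?mulr_ge0 // ltW.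
have : cvg (u @ \oo).
  apply/cauchy_cvgP/cauchy_exP => e' e'0.
  have [e e0 ee'] : exists2 e : R, 0 < e & e' = e%:C.
    by exists (complex.Re e'); rewrite -?ltcR ?RRe_real // gtr0_real.
  have [N hN] := geometric_lt (C * 2) e0.
  exists (u N). exists N => // m /= Nm.
  rewrite -ball_normE /= ee' -rnorm_ltC rnormB.
  by apply: le_lt_trans hN; rewrite -(subnKC Nm); apply: step'.
move=> /cvg_ex[l ul]; exists l => n.
apply/ler_addgt0Pl => e e0.
have : nbhs l [set w | rnorm (w - l) < e] by apply/nbhs_rnorm; exists e.
move=> /ul[N _ hN].
have := hN (n + N)%N (leq_addl _ _) => /= h1.
apply: le_trans (rnormBD _ (u (n + N)%N) _) _.
by apply: lerD => //; rewrite rnormB ltW.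
Qed.
End RealNorm.

(** * The closed graph theorem *)

Section ClosedGraph.
Variable R : realType.

(** The Baire property: the [F n] contain a small ball inside every ball, and
    nested balls with geometrically decreasing radii meet in a common point. *)
Lemma nested_balls (V : completeNormedModType R[i]) (F : nat -> set V) :
  (forall n (c : V) (r : R), 0 < r -> exists c' r', 0 < r' /\
     forall a, rnorm (a - c') < r' -> rnorm (a - c) < r /\ F n a) ->
  exists a, forall n, F n a.
Proof.
move=> hF.
have /choice[g hg] : forall p : nat * (V * R), exists q : V * R,
    0 < p.2.2 -> 0 < q.2 /\
    forall a, rnorm (a - q.1) < q.2 -> rnorm (a - p.2.1) < p.2.2 /\ F p.1 a.
  move=> [n [c r]] /=; case: (ltP 0 r) => [r0|_]; last by exists (0, 0).
  by have [c' [r' h]] := hF n c r r0; exists (c', r').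
(* halving the radius keeps the limit of the centres inside the open balls *)
pose shrink n (p : V * R) := (p.1, Num.min (p.2 / 2) (1 / 2 ^+ n)).
pose s := fix s n := if n is m.+1 then g (m, shrink m (s m)) else (0 : V, 1 : R).
have sr n : 0 < (s n).2.
  elim: n => [|n IH] //=.
  have [] := hg (n, shrink n (s n)) => //=.
  by rewrite lt_min divr_gt0 //= divr_gt0 // exprn_gt0.
have sh n a : rnorm (a - (s n.+1).1) < (s n.+1).2 ->
    [/\ rnorm (a - (s n).1) < (s n).2 / 2, rnorm (a - (s n).1) < 1 / 2 ^+ n & F n a].
  have [|_ h] := hg (n, shrink n (s n)).
    by rewrite /= lt_min divr_gt0 //= divr_gt0 // exprn_gt0.
  by move=> /h[/=]; rewrite lt_min => /andP[].
have hc n : rnorm ((s n.+1).1 - (s n).1) < 1 / 2 ^+ n.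
  by have [|_ //] := sh n (s n.+1).1; rewrite subrr rnorm0.
have [l hl] : exists l : V, forall n, rnorm (l - (s n).1) <= 1 * 2 / 2 ^+ n.
  by apply: complete_geometric => n; apply: ltW.
have half n : (s n).2 / 2 <= (s n).2.
  by rewrite ler_pdivrMr // ler_peMr ?ltW // ltr1n.
(* every later ball lies in the ball of half the radius around [(s n).1] *)
have tail n k a : rnorm (a - (s (n + k).+1).1) < (s (n + k).+1).2 ->
    rnorm (a - (s n).1) < (s n).2 / 2.
  elim: k a => [|k IH] a; first by rewrite addn0 => /(sh n)[].
  rewrite addnS => /(sh (n + k).+1)[h _ _]; apply: IH.
  exact: lt_le_trans h (half _).
exists l => n; have [//|_ _ //] := sh n l.
have [k hk] := geometric_lt (1 * 2) (divr_gt0 (sr n.+1) (ltr0Sn _ 1)).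
have mono : 1 * 2 / 2 ^+ (n.+1 + k).+1 <= 1 * 2 / 2 ^+ k :> R.
  rewrite ler_pM2l // lef_pV2 ?posrE ?exprn_gt0 // ler_weXn2l ?ler1n //.
  by rewrite -addSn leq_addl.
have h1 : rnorm ((s (n.+1 + k).+1).1 - (s n.+1).1) < (s n.+1).2 / 2.
  by apply: (tail n.+1 k); rewrite subrr rnorm0.
have have h2 := hl (n.+1 + k).+1.
apply: le_lt_trans (rnormBD l (s (n.+1 + k).+1).1 (s n.+1).1) _.
rewrite [ltRHS]splitr; apply: ler_ltD; last first.
  by apply: (tail n.+1 k); rewrite subrr rnorm0.
by apply/ltW; apply: le_lt_trans hk; apply: le_trans mono.
Qed.

(** By the Baire property some sublevel set of [rnorm (T b)] is dense in a ball.
    Differences and scaling turn this into an approximate statement at every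
    [a]: up to an error of half its norm, [a] is some [b] with [rnorm (T b)]
    controlled by [rnorm a]. Iterating on the error writes [a] as a series whose
    image converges, and closedness identifies the sum of the image with
    [T a]. *)
Theorem closed_graph (V W : completeNormedModType R[i]) (T : {linear V -> W}) :
  (forall v w, (forall e : R, 0 < e ->
       exists a, rnorm (a - v) < e /\ rnorm (T a - w) < e) ->
     T v = w) ->
  exists2 M : R, 0 < M & forall v, rnorm (T v) <= M * rnorm v.
Proof.
move=> cg.
have [[n [c [r [r0 hr]]]]|hno] := pselect (exists n (c : V) (r : R), 0 < r /\
    forall a, rnorm (a - c) < r -> forall e : R, 0 < e ->
      exists2 b, rnorm (b - a) < e & rnorm (T b) <= n%:R); last first.
  have [a ha] : exists a : V, forall n, exists2 e : R, 0 < e &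
      forall b, rnorm (b - a) < e -> n%:R < rnorm (T b).
    apply: nested_balls => n c r r0.
    apply: contrapT => hb; apply: hno; exists n, c, r; split=> // a ac e e0.
    apply: contrapT => hb'; apply: hb.
    exists a, (Num.min (e / 2) (r - rnorm (a - c))).
    rewrite lt_min subr_gt0 ac divr_gt0 //; split=> // b.
    rewrite lt_min => /andP[be br].
    split; first by have := rnormBD b a c; lra.
    exists (e / 2); first by rewrite divr_gt0.
    move=> d db; rewrite ltNge; apply/negP => Td; apply: hb'; exists d => //.
    by have := rnormBD d b a; lra.
  have [e e0 /(_ a)] := ha (Num.truncn (rnorm (T a))).+1.
  rewrite subrr rnorm0 => /(_ e0) /lt_trans /(_ (truncnS_gt _)).
  by rewrite ltxx.
(* [t *: a] has norm [r / 2]; it is the difference of [c + t *: a] and [c], and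
   both are within [r / 8] of points where [rnorm (T _)] is at most [n]. The
   error [r / 4] is half the norm of [t *: a], and [2 * n / t] is at most
   [K * rnorm a]. *)
have [K K0 hK] : exists2 K : R, 0 < K & forall a, exists b,
    rnorm (a - b) <= rnorm a / 2 /\ rnorm (T b) <= K * rnorm a.
  exists (4 * (n%:R + 1) / r); first by rewrite divr_gt0 // mulr_gt0 // ltr_wpDl.
  move=> a; have [->|a0] := eqVneq a 0.
    by exists 0; rewrite subr0 linear0 !rnorm0; lra.
  have na := rnorm_gt0 a0.
  pose t : R := r / 2 / rnorm a; have t0 : 0 < t by rewrite !divr_gt0.
  have tC : rnorm (t%:C : R[i]^o) = t by rewrite rnorm_real gtr0_norm.
  have rt : t * rnorm a = r / 2 by rewrite /t divfK // gt_eqF.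
  have [||b1 hb1 Tb1] := hr (c + t%:C *: a) _ (r / 8).
  - by rewrite addrC addKr rnormZ tC; lra.
  - by rewrite divr_gt0.
  have [||b2 hb2 Tb2] := hr c _ (r / 8).
  - by rewrite subrr rnorm0.
  - by rewrite divr_gt0.
  pose d := b1 - b2.
  have hd : rnorm (t%:C *: a - d) < r / 4.
    have -> : t%:C *: a - d = (b2 - c) - (b1 - (c + t%:C *: a)).
      by rewrite /d !opprB addrCA !addrA subrK.
    by have := rnormD (b2 - c) (- (b1 - (c + t%:C *: a))); rewrite rnormN; lra.
  have Td : rnorm (T d) <= n%:R + n%:R.
    by rewrite linearB; have := rnormD (T b1) (- T b2); rewrite rnormN; lra.
  have tV : rnorm ((t^-1)%:C : R[i]^o) = t^-1 by rewrite rnorm_real gtr0_norm ?invr_gt0.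
  have n0 : 0 <= n%:R :> R by [].
  exists ((t^-1)%:C *: d); split.
    have -> : a - (t^-1)%:C *: d = (t^-1)%:C *: (t%:C *: a - d).
      by rewrite [RHS]scalerBr scalerA -rmorphM /= mulVf ?gt_eqF // scale1r.
    rewrite rnormZ tV -(ler_pM2l t0) mulrA divff ?gt_eqF // mul1r; lra.
  rewrite linearZ rnormZ tV -(ler_pM2l t0) mulrA divff ?gt_eqF // mul1r.
  have -> : t * (4 * (n%:R + 1) / r * rnorm a) =
      t * rnorm a * (4 * (n%:R + 1) / r) by ring.
  rewrite rt; have -> : r / 2 * (4 * (n%:R + 1) / r) = 2 * (n%:R + 1).
    by field; apply: lt0r_neq0.
  lra.
have [g /all_and2[hg1 hg2]] := choice hK.
exists (K * 2) => [|a]; first by rewrite mulr_gt0.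
(* [s k] is the error after [k] corrections, so [a - s k] is a partial sum *)
pose s := fix s k := if k is m.+1 then s m - g (s m) else a.
have hs k : rnorm (s k) <= rnorm a / 2 ^+ k.
  elim: k => [|k IH]; first by rewrite expr0 divr1.
  apply: le_trans (hg1 (s k)) _.
  by rewrite exprS invfM [2^-1 * _]mulrC mulrA ler_pM2r.
have [l hl] : exists l : W, forall k,
    rnorm (l - T (a - s k)) <= K * rnorm a * 2 / 2 ^+ k.
  apply: complete_geometric => k /=.
  have -> : T (a - (s k - g (s k))) - T (a - s k) = T (g (s k)).
    by rewrite -linearB; congr (T _); apply/eqP; rewrite subr_eq opprB addrCA.
  apply: le_trans (hg2 _) _; rewrite -mulrA ler_pM2l //.
have lT : T a = l.
  apply: cg => e e0.
  pose C := rnorm a + K * rnorm a * 2.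
  have C0 : 0 <= C by rewrite addr_ge0 ?mulr_ge0 ?rnorm_ge0 // ltW.
  have [N CN] := geometric_lt C e0.
  have CE : C / 2 ^+ N = rnorm a / 2 ^+ N + K * rnorm a * 2 / 2 ^+ N.
    by rewrite /C mulrDl.
  have h1 := hs N; have h2 := hl N.
  have h3 := le_trans (rnorm_ge0 _) h1; have h4 := le_trans (rnorm_ge0 _) h2.
  exists (a - s N); split; last by rewrite rnormB; lra.
  by rewrite addrAC subrr add0r rnormN; lra.
rewrite lT; have := hl 0%N.
by rewrite /= subrr linear0 subr0 expr0 divr1; lra.
Qed.
End ClosedGraph.

(** * Characters of a commutative Banach algebra *)

Section BanachAlgebra.
Variables (R : realType) (A : commBanachAlgType R[i]).
Implicit Types (a b c : A) (x : character A).

Lemma bmulDr a b c : a ** (b + c) = a ** b + a ** c.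
Proof. by rewrite bmulC bmulDl !(bmulC _ a). Qed.

Lemma bmulZr (k : R[i]) a b : a ** (k *: b) = k *: (a ** b).
Proof. by rewrite bmulC bmulZl bmulC. Qed.

Lemma bmulBr a b c : a ** (b - c) = a ** b - a ** c.
Proof. by rewrite bmulDr -scaleN1r bmulZr scaleN1r. Qed.

Lemma bmulBl a b c : (a - b) ** c = a ** c - b ** c.
Proof. by rewrite bmulC bmulBr !(bmulC c). Qed.

Lemma bmul0 a : a ** 0 = 0.
Proof. by rewrite -[X in _ ** X](subrr a) bmulBr subrr. Qed.

Lemma functionalZ (f : {linear A -> R[i]^o}) (k : R[i]) a : f (k *: a) = k * f a.
Proof. exact: linearZ. Qed.

(** If [rnorm b] were less than one half, the series of the powers of [b] would
    converge to a solution of [l = b + b ** l], to which [x] cannot be applied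
    without giving 0 = 1. *)
Lemma character_norm1 x b : x b = 1 -> 2^-1 <= rnorm b.
Proof.
move=> xb; rewrite leNgt; apply/negP => nb.
have b0 := rnorm_ge0 b.
pose s := fix s n := if n is m.+1 then b + b ** s m else b.
have hs n : rnorm (s n.+1 - s n) <= 1 / 2 ^+ n.
  elim: n => [|n IH].
    rewrite /= addrAC subrr add0r expr0 divr1.
    by have := rnorm_bmul b b; nra.
  have -> : s n.+2 - s n.+1 = b ** (s n.+1 - s n).
    by rewrite [RHS]bmulBr /= opprD addrACA subrr add0r.
  apply: le_trans (rnorm_bmul _ _) _.
  rewrite exprS invfM mul1r; apply: ler_pM; rewrite ?rnorm_ge0 ?(ltW nb) //.
  by rewrite -[leRHS]mul1r.
have [l hl] := complete_geometric hs.
have e : l - (b + b ** l) = 0.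
  apply: rnorm_small => e e0.
  have [n hn] := geometric_lt (1 * 2) (divr_gt0 e0 (ltr0Sn R 1)).
  apply: le_trans (rnormBD _ (s n.+1) _) _; rewrite [e]splitr; apply: lerD.
    apply: le_trans (hl _) _; apply: ltW; apply: le_lt_trans hn.
    by rewrite ler_pM2l // lef_pV2 ?posrE ?exprn_gt0 // ler_weXn2l ?ler1n.
  rewrite /= opprD addrACA subrr add0r -bmulBr.
  apply: le_trans (rnorm_bmul _ _) _; have := hl n; rewrite rnormB.
  by have := rnorm_ge0 (s n - l); nra.
have := congr1 x e; rewrite linearB linearD linear0 char_mul xb mul1r.
by move=> /eqP; rewrite opprD addrCA subrr addr0 oppr_eq0 oner_eq0.
Qed.

(** Automatic continuity of characters. The sharp constant is 1, but any constant
    independent of [x] serves the estimates that follow. *)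
Lemma character_bounded x a : rnorm (x a : R[i]^o) <= 2 * rnorm a.
Proof.
have [->|xa0] := eqVneq (x a) 0; first by rewrite rnorm0 mulr_ge0 ?rnorm_ge0.
have n0 : 0 < rnorm (x a : R[i]^o) by apply: rnorm_gt0.
have /character_norm1 : x ((x a)^-1 *: a) = 1 by rewrite functionalZ mulVf.
rewrite rnormZ => h.
have : rnorm (x a : R[i]^o) * rnorm ((x a)^-1 : R[i]^o) = 1.
  by rewrite -rnormM divff // -[1]/(1%:C) rnorm_real normr1.
have := rnorm_ge0 a; nra.
Qed.

Lemma character_kernel_closed x a :
  (forall e : R, 0 < e -> exists2 b, rnorm (b - a) <= e & x b = 0) -> x a = 0.
Proof.
move=> h; apply: (@rnorm_small R R[i]^o) => e e0.
have [b ba xb] := h (e / 2) (divr_gt0 e0 (ltr0Sn R 1)).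
have -> : x a = x (a - b) by rewrite linearB xb subr0.
apply: le_trans (character_bounded _ _) _.
by rewrite rnormB; lra.
Qed.

(** Compare the two sides on squares. *)
Lemma proportional_characters x1 x2 (k : R[i]) :
  (forall a, x1 a = k * x2 a) -> k = 1.
Proof.
move=> h; have [a a0] := char_neq0 x1.
move: a0 (h (a ** a)); rewrite !char_mul (h a) => a0 e.
apply/eqP; rewrite -subr_eq0; apply/eqP; apply: (mulIf (mulf_neq0 a0 a0)).
have -> : (k - 1) * (k * x2 a * (k * x2 a)) =
  k * (k * x2 a * (k * x2 a) - k * (x2 a * x2 a)) by ring.
by rewrite e subrr mulr0 mul0r.
Qed.

Lemma functional_of_kernel x (f : {linear A -> R[i]^o}) :
  (forall a, x a = 0 -> f a = 0) -> exists w : R[i], forall a, f a = w * x a.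
Proof.
move=> h; have [u u0] := char_neq0 x.
exists (f u / x u) => a.
have : f (a - (x a / x u) *: u) = 0.
  by apply: h; rewrite linearB functionalZ divfK // subrr.
rewrite linearB functionalZ => /eqP; rewrite subr_eq0 => /eqP ->.
by rewrite mulrAC [RHS]mulrAC [f u * _]mulrC.
Qed.

Lemma gelfand_continuous a : continuous (gelfand a : character A -> R[i]^o).
Proof.
move=> x.
apply: (@continuous_comp _ _ _
  (fun x : character A => (x : A -> R[i]^o) : {ptws A -> R[i]^o})
  (fun f : {ptws A -> R[i]^o} => f a)).
  exact: initial_continuous.
exact: proj_continuous.
Qed.

Lemma near_neq0 a x : x a != 0 -> nbhs x [set x' : character A | x' a != 0].
Proof.
move=> xa; have : nbhs (gelfand a x) (~` [set (0 : R[i]^o)]).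
  apply: open_nbhs_nbhs; split; last by apply/eqP.
  exact/closed_openC/accessible_closed_set1/hausdorff_accessible/norm_hausdorff.
move=> /(@gelfand_continuous a x) h.
by apply: (@filterS _ (nbhs x) _ _ _ _ h) => x' /eqP.
Qed.

Lemma supp_near a x : ~ gelfand_supp a x -> nbhs x [set x' : character A | x' a = 0].
Proof.
move=> /existsNP[U /not_implyP[xU hU]]; apply: filterS xU => x' Ux'.
by apply: contrapT => /eqP a0; apply: hU; exists x'.
Qed.

Lemma supp_neq0 a x : x a != 0 -> gelfand_supp a x.
Proof. by move=> a0; apply: subset_closure. Qed.

Lemma suppMl a b : gelfand_supp (a ** b) `<=` gelfand_supp a.
Proof.
apply: closure_subset => x /=; rewrite /gelfand char_mul mulf_eq0.
by move=> /norP[].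
Qed.

Lemma compact_suppM a b : compact_supp a -> compact_supp (a ** b).
Proof.
move=> ca; apply: subclosed_compact ca _; first exact: closed_closure.
exact: suppMl.
Qed.
End BanachAlgebra.

(** * Local units from condition (M) *)

Section TauberianM.
Variables (R : realType) (A : commBanachAlgType R[i]).
Hypotheses (tauA : tauberian A) (MA : condition_M A).
Implicit Types (a b c : A) (x : character A).

Lemma semisimple0 a : (forall x, x a = 0) -> a = 0.
Proof.
by move=> h; have [ss _] := tauA; rewrite -[a = 0]/([set 0] a) -ss => x _ /=.
Qed.

Lemma semisimple_eq a b : (forall x, x a = x b) -> a = b.
Proof.
move=> h; apply/eqP; rewrite -subr_eq0; apply/eqP/semisimple0 => x.
by rewrite linearB h subrr.
Qed.

Lemma compact_supp_dense a (e : R) : 0 < e ->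
  exists2 c, compact_supp c & rnorm (c - a) < e.
Proof.
move=> e0; have [_ dA] := tauA.
have /nbhs_interior : nbhs a [set c | rnorm (c - a) < e] by apply/nbhs_rnorm; exists e.
move=> /nbhs_singleton aU.
have [|c [/interior_subset ce cc]] :=
  dA _ _ (open_interior [set c | rnorm (c - a) < e]).
  by exists a.
by exists c.
Qed.

Lemma compact_supp_neq0 x : exists2 c, compact_supp c & x c != 0.
Proof.
apply: contrapT => h; have [u /negP[]] := char_neq0 x; apply/eqP.
apply: character_kernel_closed => e e0; have [c cc ce] := compact_supp_dense u e0.
exists c; first exact: ltW.
by apply/eqP; apply: contrapT => /negP xc; apply: h; exists c.
Qed.

(** Usable form of condition (M): since [b ** a] and [a] agree near [x], the
    germ of [a] at [x] has representatives of arbitrarily small norm whose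
    support lies in [U]. *)
Lemma ditkin x a (U : set (character A)) (e : R) :
  x a = 0 -> nbhs x U -> 0 < e ->
  exists b, [/\ nbhs x [set x' : character A | x' b = 1],
    gelfand_supp b `<=` U & rnorm (b ** a) < e].
Proof.
move=> xa xU e0; have [_ /(_ x a U xa xU) h] := MA.
have : (ereal_inf [set (complex.Re `|b ** a|)%:E | b in
      [set b : A | (exists2 V, nbhs x V & forall y, V y -> gelfand b y = 1%R) /\
                   gelfand_supp b `<=` U]] < e%:E)%E by rewrite h lte_fin.
move=> /ereal_inf_lt[_ [b [[V xV bV] bU] <-]]; rewrite lte_fin => be.
by exists b; split => //; apply: filterS xV.
Qed.

(** An infimum equal to 0 is not that of the empty set, so condition (M) for
    [a = 0] is already a statement of existence. *)
Lemma local_unit x (U : set (character A)) : nbhs x U ->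
  exists b, (nbhs x [set x' : character A | x' b = 1]) /\ gelfand_supp b `<=` U.
Proof.
move=> xU; have [|b [? ? _]] := @ditkin x 0 U 1 _ xU ltr01; last by exists b.
by rewrite linear0.
Qed.
End TauberianM.

(** * The support of a separating functional *)

(** Otherwise the sets whose complement in [K] satisfies [P] form a proper
    filter, and it cannot have a cluster point in [K]. *)
Lemma compact_covering_ind (T : topologicalType) (K : set T) (P : set T -> Prop) :
  P set0 -> (forall U V, P U -> P V -> P (U `|` V)) ->
  (forall U V, U `<=` V -> P V -> P U) ->
  compact K -> (forall x, K x -> exists2 U, nbhs x U & P U) -> P K.
Proof.
move=> P0 PU PS cK loc; apply: contrapT => nPK.
pose F : set_system T := [set W | P (K `\` W)].
have FF : ProperFilter F.
  split; first by rewrite /F /= setD0.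
  split; first by rewrite /F /= setDT.
  - move=> U V FU FV; rewrite /F /= setDIr; exact: PU.
  - move=> U V UV; apply: PS; exact: setDS.
have FK : F K by rewrite /F /= setDv.
have [x [Kx xF]] := cK F FF FK.
have [U xU PUx] := loc x Kx.
have FU : F (~` U) by rewrite /F /= setDE setCK; apply: PS PUx; exact: subIsetr.
by have [z []] := xF _ _ FU xU.
Qed.

Section Support.
Variables (R : realType) (A : commBanachAlgType R[i]).
Hypotheses (tauA : tauberian A) (MA : condition_M A).
Implicit Types (a b c : A) (x : character A) (f : {linear A -> R[i]^o}).

Definition separating_functional f := forall a b, a ** b = 0 -> f a * f b = 0.

(** The functional depends only on the germ at [x] of the Gelfand transform. It
    may still depend on more than the value at [x]. *)
Definition supported_at f x :=
  forall a, nbhs x [set x' : character A | x' a = 0] -> f a = 0.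

Lemma bmul_disjoint_supp a b (U : set (character A)) :
  gelfand_supp b `<=` U -> (forall x, U x -> x a = 0) -> a ** b = 0.
Proof.
move=> bU aU; apply: (semisimple0 tauA) => x; rewrite char_mul.
have [->|b0] := eqVneq (x b) 0; first by rewrite mulr0.
by rewrite aU ?mul0r //; apply/bU/supp_neq0.
Qed.

(** If [f] had no support, near each [x] of the support of [c] some [a] would
    vanish with [f a != 0]; a local unit [e] supported there satisfies
    [a ** (e ** b) = 0], hence [f (e ** b) = 0] for all [b]. Patching the local
    units over the compact support of [c] gives such an [e] with [e ** c = c],
    and then [f c = 0]. *)
Lemma exists_support f c : separating_functional f -> compact_supp c -> f c != 0 ->
  exists x, supported_at f x.
Proof.
move=> sf cc fc; apply: contrapT => nosupp.
pose P (W : set (character A)) :=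
  exists e, (forall x, W x -> x e = 1) /\ (forall a, f (e ** a) = 0).
have [||||x _|e [e1 fe]] := @compact_covering_ind _ (gelfand_supp c) P.
- by exists 0; split => // a; rewrite bmulC bmul0 linear0.
- move=> U V [u [u1 fu]] [v [v1 fv]].
  (* [1 - e] is the product of [1 - u] and [1 - v] *)
  exists (u + v - u ** v); split=> [x|a].
    rewrite linearB linearD char_mul => -[/u1 ->|/v1 ->]; rewrite ?mul1r ?mulr1.
      by rewrite addrK.
    by rewrite addrAC subrr add0r.
  by rewrite bmulBl bmulDl linearB linearD -bmulA !fu fv addr0 subr0.
- by move=> U V UV [e [e1 fe]]; exists e; split=> // x /UV /e1.
- exact: cc.
- have [a [xa fa]] : exists a, nbhs x [set x' : character A | x' a = 0] /\ f a != 0.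
    apply: contrapT => h; apply: nosupp; exists x => a xa.
    by apply/eqP; apply: contrapT => /negP fa; apply: h; exists a.
  have [e [e1 eU]] := local_unit MA xa.
  exists [set x' : character A | x' e = 1] => //; exists e; split=> // b.
  have /sf : a ** (e ** b) = 0.
    by apply: bmul_disjoint_supp (subset_trans (@suppMl _ _ _ _) eU) _.
  by move/eqP; rewrite mulf_eq0 (negPf fa) => /eqP.
- have := fe c; suff -> : e ** c = c by move/eqP; rewrite (negPf fc).
  apply: (semisimple_eq tauA) => x; rewrite char_mul.
  have [->|c0] := eqVneq (x c) 0; first by rewrite mulr0.
  by rewrite e1 ?mul1r //; apply: supp_neq0.
Qed.

Lemma supported_supp f x c : supported_at f x -> f c != 0 -> gelfand_supp c x.
Proof. by move=> fx; apply: contra_neqP => /supp_near /fx. Qed.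

(** For a bounded functional, depending on the germ at [x] and depending on the
    value at [x] are the same, because condition (M) makes the elements that
    vanish near [x] dense in the kernel of [x]. *)
Lemma supported_kernel f x (M : R) : supported_at f x -> 0 < M ->
  (forall a, rnorm (f a) <= M * rnorm a) -> forall a, x a = 0 -> f a = 0.
Proof.
move=> fx M0 fM a xa; apply: (@rnorm_small R R[i]^o) => e e0.
have [b [b1 _ ba]] := ditkin MA xa (@filterT _ (nbhs x) _) (divr_gt0 e0 M0).
have : f (a - b ** a) = 0.
  apply: fx; apply: filterS b1 => x' /= b1.
  by rewrite linearB char_mul b1 mul1r subrr.
rewrite linearB => /eqP; rewrite subr_eq0 => /eqP ->.
apply: le_trans (fM _) _; rewrite mulrC -ler_pdivlMr //; exact: ltW.
Qed.
End Support.

(** * Automatic continuity of separating bijections *)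

Section SeparatingMaps.
Variables (R : realType) (A B : commBanachAlgType R[i]).
Hypotheses (tauA : tauberian A) (MA : condition_M A) (tauB : tauberian B).
Variable T : {linear A -> B}.
Hypotheses (sepT : separating T) (bijT : bijective T).
Implicit Types (a b c : A) (x : character A) (y : character B).

Definition pullback y : {linear A -> R[i]^o} := char_fun y \o T.

Lemma pullback_separating y : separating_functional (pullback y).
Proof. by move=> a b /sepT Tab; rewrite /pullback /= -char_mul Tab linear0. Qed.

Lemma pullback_neq0 y : exists a, pullback y a != 0.
Proof.
have [b b0] := char_neq0 y; have [S TS ST] := bijT.
by exists (S b); rewrite /pullback /= ST.
Qed.

(** The good points of the spectrum of [A]: a germ matters there only through its
    value, so [T] is continuous as seen through such a point. *)
Definition weighted_image x :=
  exists y (w : R[i]), w != 0 /\ forall a, pullback y a = w * x a.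

Lemma weighted_imageP x y :
  (forall a, x a = 0 -> pullback y a = 0) -> weighted_image x.
Proof.
move=> /functional_of_kernel[w fw]; exists y, w; split=> //.
have [a] := pullback_neq0 y; apply: contra_neq => w0.
by rewrite fw w0 mul0r.
Qed.

(** By injectivity an element supported in [V] has a nonzero image, and the
    functional that detects this has its support in [V]. *)
Lemma exists_support_in (V : set (character A)) x0 : nbhs x0 V ->
  exists x y, V x /\ supported_at (pullback y) x.
Proof.
move=> x0V; have [e [/nbhs_singleton /= e1 eV]] := local_unit MA x0V.
have [u cu xu] := compact_supp_neq0 tauA x0.
pose c := u ** e.
have Tc : T c != 0.
  apply/eqP => Tc; suff : x0 c = 0 by rewrite char_mul e1 mulr1; apply/eqP.
  have -> : c = 0 by apply: (bij_inj bijT); rewrite Tc linear0.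
  by rewrite linear0.
have [y yTc] : exists y, pullback y c != 0.
  apply: contrapT => h; move/eqP: Tc; apply; apply: (semisimple0 tauB) => y.
  by apply: contrapT => /eqP yTc; apply: h; exists y.
have cc := compact_suppM (b := e) cu.
have [x fx] := exists_support tauA MA (pullback_separating y) cc yTc.
exists x, y; split=> //; apply: eV.
have := supported_supp fx yTc; rewrite /c bmulC; exact: suppMl.
Qed.

(** At a point outside [weighted_image] the functional does not vanish on the
    kernel of [x]. Take [a] in this kernel with a large value; by condition (M)
    the germ of [a] at [x], which determines the value, has representatives of
    small norm supported in [V]. *)
Lemma small_bump (V : set (character A)) (e M : R) :
  open V -> (exists x, V x) -> ~ (exists x, V x /\ weighted_image x) -> 0 < e ->
  exists c x y, [/\ (forall x', ~ V x' -> x' c = 0), V x,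
    supported_at (pullback y) x, rnorm c < e & M <= rnorm (pullback y c)].
Proof.
move=> oV [x0 Vx0] hV e0.
have [x [y [Vx fx]]] := exists_support_in (open_nbhs_nbhs (conj oV Vx0)).
have [a [xa ya]] : exists a, x a = 0 /\ pullback y a != 0.
  apply: contrapT => h; apply: hV; exists x; split=> //.
  apply: (@weighted_imageP x y) => a xa.
  by apply: contrapT => /eqP ya; apply: h; exists a.
pose k : R[i] := (Num.max M 0)%:C / pullback y a.
have [b [b1 bV be]] : exists b, [/\ nbhs x [set x' : character A | x' b = 1],
    gelfand_supp b `<=` V & rnorm (b ** (k *: a)) < e].
  apply: ditkin => //; first by rewrite functionalZ xa mulr0.
  exact: open_nbhs_nbhs.
exists (b ** (k *: a)), x, y; split=> //.
  move=> x' nV; rewrite char_mul.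
  have [->|b0] := eqVneq (x' b) 0; first by rewrite mul0r.
  by exfalso; apply/nV/bV/supp_neq0.
have : pullback y (k *: a - b ** (k *: a)) = 0.
  apply: fx; apply: filterS b1 => x' /= b1.
  by rewrite linearB char_mul b1 mul1r subrr.
rewrite linearB => /eqP; rewrite subr_eq0 => /eqP <-.
rewrite functionalZ divfK // rnorm_real.
by apply: le_trans (ler_norm _); rewrite le_max lexx.
Qed.

(** If all points of [V] were the same character, vanishing at a point of [V]
    would be vanishing near it, and a functional supported in [V] would be a
    multiple of the evaluation there. *)
Lemma split_open (V : set (character A)) :
  open V -> (exists x, V x) -> ~ (exists x, V x /\ weighted_image x) ->
  exists V1 V2 : set (character A),
    [/\ open V1, open V2, (exists x, V1 x), (exists x, V2 x) &
    [/\ V1 `<=` V, V2 `<=` V & forall x, V1 x -> V2 x -> False]].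
Proof.
move=> oV [x0 Vx0] hV.
have nbV x : V x -> nbhs x V by move=> Vx; exact: open_nbhs_nbhs.
have [u [v [a [Vu Vv uva]]]] : exists u v a, [/\ V u, V v & u a != v a].
  apply: contrapT => h.
  have [x [y [Vx fx]]] := exists_support_in (nbV _ Vx0).
  apply: hV; exists x; split=> //; apply: (@weighted_imageP x y) => a xa.
  apply: fx; apply: filterS (nbV _ Vx) => x' Vx' /=.
  rewrite -xa; apply: contrapT => /eqP nx; apply: h; exists x', x, a; split=> //.
have := @norm_hausdorff _ R[i]^o; rewrite open_hausdorff.
move=> /(_ (gelfand a u) (gelfand a v) uva) [[P Q] /= [Pu Qv] [oP oQ PQ]].
rewrite !inE in Pu Qv.
have cg := @gelfand_continuous R A a.
exists (V `&` gelfand a @^-1` P), (V `&` gelfand a @^-1` Q); split.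
- apply: openI => //; by move/continuousP: cg; apply.
- apply: openI => //; by move/continuousP: cg; apply.
- by exists u.
- by exists v.
- split; [exact: subIsetl|exact: subIsetl|].
  move=> x [_ Px] [_ Qx]; have : (P `&` Q) (gelfand a x) by [].
  by move/eqP: PQ => ->.
Qed.

(** A gliding hump. Otherwise, repeated splitting of [U] produces infinitely many
    disjoint open sets [P n] without points of [weighted_image], and each carries
    a bump [c n] of norm at most [2 ^- n] with a value of size at least [n]
    under some [pullback (y n)]. Their sum [l] agrees with [c n] on [P n], so
    the value of [y n] at the fixed element [T l] has size at least [n], although
    all characters satisfy the same bound. *)
Lemma weighted_image_dense (U : set (character A)) x0 :
  open U -> U x0 -> exists x, U x /\ weighted_image x.
Proof.
move=> oU Ux0; apply: contrapT => hU.
have /choice[g hg] : forall V : set (character A),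
   exists p : set (character A) * set (character A),
   open V -> (exists x, V x) -> ~ (exists x, V x /\ weighted_image x) ->
   [/\ open p.1, open p.2, (exists x, p.1 x), (exists x, p.2 x) &
    [/\ p.1 `<=` V, p.2 `<=` V & forall x, p.1 x -> p.2 x -> False]].
  move=> V; have [[oV [eV nV]]|h] := pselect (open V /\ (exists x, V x) /\
      ~ (exists x, V x /\ weighted_image x)).
    by have [V1 [V2 h]] := split_open oV eV nV; exists (V1, V2).
  by exists (V, V) => oV eV nV; exfalso; apply: h.
(* [S n] is what is left of [U] after the pieces [P 0], ..., [P n.-1] *)
pose S := fix S n := if n is m.+1 then (g (S m)).2 else U.
have good V : V `<=` U -> ~ (exists x, V x /\ weighted_image x).
  by move=> VU [x [/VU Ux wx]]; apply: hU; exists x.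
have hS n : [/\ open (S n), (exists x, S n x) & S n `<=` U].
  elim: n => [|n [oS eS SU]]; first by split => //; exists x0.
  have [_ ? _ ? [_ h _]] := hg _ oS eS (good _ SU); split=> //.
  exact: subset_trans SU.
pose P n := (g (S n)).1.
have hP n : [/\ open (P n), (exists x, P n x), P n `<=` S n, S n.+1 `<=` S n &
    forall x, P n x -> S n.+1 x -> False].
  by have [oS eS SU] := hS n; have [? _ ? _ []] := hg _ oS eS (good _ SU).
have decS n k : S (n + k)%N `<=` S n.
  elim: k => [|k IH]; first by rewrite addn0.
  by rewrite addnS; apply: subset_trans IH; have [] := hP (n + k)%N.
have disj n m x : P n x -> P m x -> n = m.
  wlog : n m / (n < m)%N => [H|nm] Pn Pm.
    by case: (ltngtP n m) => // h; [exact: H|symmetry; exact: H].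
  have [_ _ _ _ d] := hP n; exfalso; apply: (d x Pn).
  have [_ _ sm _ _] := hP m; apply: (decS n.+1 (m - n.+1)%N); rewrite subnKC //.
  exact: sm.
have /choice[c /choice[x /choice[y hc]]] : forall n, exists c x y,
    [/\ (forall x', ~ P n x' -> x' c = 0), P n x, supported_at (pullback y) x,
    rnorm c < 1 / 2 ^+ n & n%:R <= rnorm (pullback y c)].
  move=> n; have [oP [x Px] PS _ _] := hP n; apply: small_bump => //.
  - by exists x.
  - by have [_ _ SU] := hS n; apply: good; apply: subset_trans SU.
pose s n := \sum_(i < n) c i.
have [l hl] : exists l : A, forall n, rnorm (l - s n) <= 1 * 2 / 2 ^+ n.
  apply: complete_geometric => n; have [_ _ _ /ltW h _] := hc n.
  by rewrite /s big_ord_recr /= addrAC subrr add0r.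
have xl n x' : P n x' -> x' l = x' (c n).
  move=> Px'; apply/eqP; rewrite -subr_eq0 -linearB; apply/eqP.
  apply: character_kernel_closed => e e0; have [N hN] := geometric_lt (1 * 2) e0.
  pose m := maxn N n.+1.
  have nm : (n < m)%N by rewrite leq_maxr.
  exists (s m - c n).
    rewrite opprB addrA subrK rnormB; apply: le_trans (hl _) _.
    apply: ltW; apply: le_lt_trans hN.
    by rewrite ler_pM2l // lef_pV2 ?posrE ?exprn_gt0 // ler_weXn2l ?ler1n // leq_maxl.
  rewrite /s (bigD1 (Ordinal nm)) //= addrAC subrr add0r linear_sum big1 // => i.
  have [h _ _ _ _] := hc i; move=> /eqP ni; apply: h => Pi.
  apply: ni; apply: val_inj => /=.
  exact: disj Pi Px'.
have big n : n%:R <= 2 * rnorm (T l).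
  have [_ Px fx _ h] := hc n; apply: le_trans h _.
  have : pullback (y n) (l - c n) = 0.
    apply: fx; have [oP _ _ _ _] := hP n.
    have : nbhs (x n) (P n) by apply: open_nbhs_nbhs.
    by apply: filterS => x' /xl; rewrite /= linearB => ->; rewrite subrr.
  rewrite linearB => /eqP; rewrite subr_eq0 => /eqP <-.
  exact: character_bounded.
have := big (Num.truncn (2 * rnorm (T l))).+1.
by rewrite leNgt truncnS_gt.
Qed.

Lemma weighted_image_separates d : (forall x, weighted_image x -> x d = 0) -> d = 0.
Proof.
move=> Gd; apply: (semisimple0 tauA) => x; apply: contrapT => /eqP /near_neq0.
set U := [set x' : character A | _] => xU.
have [|x' [/interior_subset /= xd' /Gd /eqP]] :=
  weighted_image_dense (open_interior U) (x0 := x).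
  exact: xU.
by rewrite (negPf xd').
Qed.

(** The closed graph theorem applies: if [a'] tends to [a] and [T a'] to
    [b = T (S b)], then [a - S b] vanishes at every point of [weighted_image],
    where [T] followed by [y] is continuous. *)
Theorem separating_bounded :
  exists2 M : R, 0 < M & forall a, rnorm (T a) <= M * rnorm a.
Proof.
apply: closed_graph => a b hab.
have [S TS ST] := bijT.
rewrite -[b]ST; congr (T _); apply/eqP; rewrite -subr_eq0; apply/eqP.
pose d := a - S b; rewrite -/d.
have Gd x : weighted_image x -> x d = 0.
  move=> [y [w [w0 yw]]].
  suff : pullback y d = 0 by rewrite yw => /eqP; rewrite mulf_eq0 (negPf w0) => /eqP.
  have K0 : 0 < 2 + rnorm (w : R[i]^o) * 2 by rewrite ltr_wpDr ?mulr_ge0 ?rnorm_ge0.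
  apply: (@rnorm_small R R[i]^o) => e e0.
  have [a' [aa' ba']] := hab _ (divr_gt0 e0 K0).
  have -> : pullback y d = y (T a' - b) + w * x (a - a').
    rewrite -yw /pullback /= -linearD; congr (y _).
    by rewrite /d !linearB ST [RHS]addrC addrA subrK.
  apply: le_trans (rnormD _ _) _; rewrite rnormM.
  have h1 := character_bounded y (T a' - b); have h2 := character_bounded x (a - a').
  rewrite [rnorm (a - a')]rnormB in h2.
  have -> : e = e / (2 + rnorm (w : R[i]^o) * 2) * (2 + rnorm (w : R[i]^o) * 2).
    by rewrite divfK // gt_eqF.
  move: aa' ba'; set t := e / _ => aa' ba'.
  by have W0 := rnorm_ge0 (w : R[i]^o); nra.
exact: weighted_image_separates.
Qed.

(** Since [T] is bounded and the elements with compact support are dense, the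
    functional [pullback y] is nonzero on one of them; so it has a support, and
    boundedness makes it a multiple of the evaluation there. *)
Theorem separating_weighted_composition y :
  exists x (w : R[i]), w != 0 /\ forall a, y (T a) = w * x a.
Proof.
have [M M0 TM] := separating_bounded.
have fM a : rnorm (pullback y a) <= 2 * M * rnorm a.
  by apply: le_trans (character_bounded _ _) _; rewrite -mulrA ler_pM2l ?TM.
have M20 : 0 < 2 * M by rewrite mulr_gt0.
have [c cc fc] : exists2 c, compact_supp c & pullback y c != 0.
  apply: contrapT => h; have [u /negP[]] := pullback_neq0 y; apply/eqP.
  apply: (@rnorm_small R R[i]^o) => e e0.
  have [c cc ce] := compact_supp_dense tauA u (divr_gt0 e0 M20).
  have fc : pullback y c = 0.
    by apply/eqP; apply: contrapT => /negP fc; apply: h; exists c.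
  have -> : pullback y u = pullback y (u - c) by rewrite linearB fc subr0.
  apply: le_trans (fM _) _; rewrite rnormB mulrC -ler_pdivlMr //; exact: ltW.
have [x fx] := exists_support tauA MA (pullback_separating y) cc fc.
have [w fw] := functional_of_kernel (supported_kernel MA fx M20 fM).
exists x, w; split=> //; apply: contra_neq fc => w0.
by rewrite fw w0 mul0r.
Qed.

(** Where [T] is a weighted evaluation with nonzero weight, [S b1 ** S b2] vanishes
    with [b1 ** b2], and such points are dense. *)
Theorem separating_inverse (S : B -> A) : cancel S T -> separating S.
Proof.
move=> ST b1 b2 b12; set d := S b1 ** S b2.
have Gd x : weighted_image x -> x d = 0.
  move=> [y [w [w0 yw]]].
  have : y b1 * y b2 = 0 by rewrite -char_mul b12 linear0.
  rewrite -[b1]ST -[b2]ST; move: (yw (S b1)) (yw (S b2)); rewrite /pullback /= => -> ->.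
  by rewrite mulrACA -char_mul => /eqP; rewrite !mulf_eq0 (negPf w0) => /eqP.
exact: weighted_image_separates.
Qed.
End SeparatingMaps.

(** * Weights of bounded weighted composition maps are multipliers *)

Section ApproximateUnits.
Variables (R : realType) (A : commBanachAlgType R[i]).

(** A bounded approximate identity converges to 1 at every character, because
    characters are bounded and nonzero. *)
Lemma approximate_unit (n : nat) (x : 'I_n -> character A) (d : R) :
  has_1_bounded_approx_id A -> 0 < d ->
  exists u : A, rnorm u <= 1 /\ forall i, rnorm (x i u - 1 : R[i]^o) <= d.
Proof.
move=> [I [le [e [[ [i0] lexx letrans ledir] e1 eA]]]] d0.
pose F := filter_from [set: I] (fun i => [set j | le i j]).
have FF : Filter F.
  apply: filter_from_filter; first by exists i0.
  move=> i j _ _; have [k [ik jk]] := ledir i j.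
  by exists k => // l kl; split; apply: letrans kl.
have near_unit i : F [set j | rnorm (x i (e j) - 1 : R[i]^o) <= d].
  have [a xa] := char_neq0 (x i).
  have n0 : 0 < rnorm (x i a : R[i]^o) by apply: rnorm_gt0.
  have : nbhs a [set b | rnorm (b - a) < d * rnorm (x i a : R[i]^o) / 2].
    apply/nbhs_rnorm; exists (d * rnorm (x i a : R[i]^o) / 2) => //.
    by rewrite divr_gt0 ?mulr_gt0.
  move=> /(eA a) h; apply: (@filterS _ F FF _ _ _ h) => j /= ja.
  rewrite -(ler_pM2r n0) -rnormM mulrBl mul1r -char_mul -linearB.
  by apply: le_trans (character_bounded _ _) _; lra.
have [k _ hk] := filter_forall FF near_unit.
exists (e k); split; first by rewrite rnorm_leC e1.
by move=> i; apply: (hk k (lexx k)).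
Qed.
End ApproximateUnits.

Section WeightedComposition.
Variables (R : realType) (A B : commBanachAlgType R[i]).
Variables (T : {linear A -> B}) (h : character B -> character A).
Variable w : character B -> R[i]^o.
Hypothesis w0 : forall y, w y != 0.
Hypothesis hT : forall (y : character B) (a : A), y (T a) = w y * h y a.

(** A local unit [b] at [h y] supported in [U] has [T b] nonzero near [y], and
    [h] maps the points where [T b] is nonzero into [U]. *)
Lemma composition_continuous : condition_M A -> continuous h.
Proof.
move=> MA y U /(local_unit MA)[b [/nbhs_singleton /= b1 bU]].
have : y (T b) != 0 by rewrite hT b1 mulr1.
move=> /near_neq0; apply: filterS => y' /=.
by rewrite hT mulf_eq0 => /norP[_ hb]; apply/bU/supp_neq0.
Qed.

Lemma weight_continuous : condition_M A -> continuous w.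
Proof.
move=> MA y; have hc := composition_continuous MA.
have [a a0] := char_neq0 (h y).
rewrite /continuous_at.
have -> : w y = gelfand (T a) y * (gelfand a (h y))^-1.
  by rewrite /gelfand hT mulfK.
have hca : gelfand a (h y') @[y' --> y] --> gelfand a (h y).
  by apply: (continuous_comp (hc y)); apply: gelfand_continuous.
apply: cvg_trans
  (_ : (gelfand (T a) y' * (gelfand a (h y'))^-1 @[y' --> y]) `=>` _).
  apply: (@near_eq_cvg _ _ (nbhs y)).
  have : nbhs y (h @^-1` [set x : character A | x a != 0]) by apply/hc/near_neq0.
  by apply: filterS => y' /= a'0; rewrite /gelfand hT mulfK.
have hV : (fun y' => (gelfand a (h y'))^-1) @ y --> (gelfand a (h y))^-1.
  exact: (@cvgV R[i] _ (nbhs y) _ (fun y' => gelfand a (h y')) _ a0 hca).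
exact: (@cvgM R[i] _ (nbhs y) _ (gelfand (T a)) _ _ _
  (@gelfand_continuous R B (T a) y) hV).
Qed.

(** The weight is the pointwise limit of the transforms of [T u], where [u] runs
    through an approximate identity in the unit ball of [A]. These [T u] have norm
    at most [M], so [M] is a BSE constant. *)
Lemma weight_BSE (M : R) : has_1_bounded_approx_id A -> 0 < M ->
  (forall a, rnorm (T a) <= M * rnorm a) -> BSE_condition w.
Proof.
move=> aiA M0 TM; exists M => // n y alpha.
set f := fun b : B => \sum_(i < n) alpha i * y i b.
have fle b : rnorm b <= 1 -> ((rnorm (f b : R[i]^o))%:E <= dual_norm f)%E.
  by move=> b1; apply: ereal_sup_ubound; exists b => //=; rewrite -rnorm_leC.
have fT r : dual_norm f = r%:E ->
    rnorm (\sum_(i < n) alpha i * w (y i) : R[i]^o) <= M * r.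
  move=> fr; apply/ler_addgt0Pl => e e0.
  pose K := \sum_(i < n) rnorm (alpha i * w (y i) : R[i]^o).
  have K0 : 0 <= K by apply: sumr_ge0 => i _; apply: rnorm_ge0.
  have K1 : 0 < K + 1 by rewrite ltr_wpDl.
  (* with this precision for [u], replacing 1 by [h (y i) u] in the sum costs at
     most [K * (e / (K + 1)) <= e] *)
  have [u [u1 hu]] := approximate_unit (fun i => h (y i)) aiA (divr_gt0 e0 K1).
  have fTu : rnorm (f (T u) : R[i]^o) <= M * r.
    have MC : rnorm ((M^-1)%:C : R[i]^o) = M^-1 by rewrite rnorm_real gtr0_norm ?invr_gt0.
    have MM : M%:C * (M^-1)%:C = 1 by rewrite -[LHS]rmorphM divff ?gt_eqF.
    have -> : f (T u) = M%:C * f ((M^-1)%:C *: T u).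
      rewrite /f mulr_sumr; apply: eq_bigr => i _.
      by rewrite functionalZ [RHS]mulrCA [M%:C * (_ * _)]mulrA MM mul1r.
    rewrite rnormM rnorm_real gtr0_norm // ler_pM2l // -lee_fin -fr; apply: fle.
    rewrite rnormZ MC -(ler_pM2l M0) mulrA divff ?gt_eqF // mul1r mulr1.
    by apply: le_trans (TM u) _; rewrite -[leRHS]mulr1 ler_pM2l.
  rewrite addrC -[X in rnorm X](subrK (f (T u))) addrC.
  apply: le_trans (rnormD _ _) _; apply: lerD => //.
  rewrite /f -sumrB.
  apply: le_trans (_ :
      \sum_(i < n) rnorm (alpha i * w (y i) : R[i]^o) * (e / (K + 1)) <= _).
    elim/big_ind2: _ => [|v s v' s' hv hs|i _]; first by rewrite rnorm0.
      by apply: le_trans (rnormD _ _) _; apply: lerD.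
    rewrite hT mulrA -[X in rnorm (X - _)]mulr1 -mulrBr [leLHS]rnormM.
    by rewrite ler_wpM2l ?rnorm_ge0 // rnormB.
  rewrite -mulr_suml -/K mulrA ler_pdivrMr //; nra.
move: fle fT; case: (dual_norm f) => [r||] fle fT.
- by rewrite -EFinM lee_fin; apply: fT.
- by rewrite gt0_muley ?lte_fin // leey.
- by have := fle 0; rewrite rnorm0 => /(_ ler01).
Qed.

Lemma weight_multiplier (M : R) : condition_M A -> has_1_bounded_approx_id A ->
  BSE_algebra B -> 0 < M -> (forall a, rnorm (T a) <= M * rnorm a) ->
  exists2 S : {linear B -> B}, is_multiplier S &
    forall b (y : character B), y (S b) = w y * y b.
Proof.
move=> MA aiA bseB M0 TM.
have : (multiplier_functions (A := B)) w.
  by rewrite -bseB; split; [exact: weight_continuous|exact: weight_BSE M0 TM].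
by move=> [_ _ [S mS Sw]]; exists S.
Qed.
End WeightedComposition.

(** * Separating bijections are isomorphisms followed by multipliers *)

Section Factorization.
Variable R : realType.

Lemma inverse_linear (A B : lmodType R[i]) (T : {linear A -> B}) (S : B -> A) :
  cancel T S -> cancel S T -> exists S' : {linear B -> A}, S' =1 S.
Proof.
move=> TS ST.
have linS : linear S.
  by move=> k u v; apply: (can_inj TS); rewrite linearP !ST.
pose m := GRing.isLinear.Build R[i] B A *:%R S linS.
pose S' : {linear B -> A} := HB.pack S m.
by exists S'.
Qed.

Lemma multiplier_gelfand (B : commBanachAlgType R[i]) (S : {linear B -> B})
  (y : character B) :
  is_multiplier S -> exists k : R[i], forall b, y (S b) = k * y b.
Proof.
move=> [_ mS]; have [c c0] := char_neq0 y.
exists (y (S c) / y c) => b.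
have := congr1 y (mS c b); rewrite !char_mul => e.
by rewrite mulrAC -e mulrC mulKf.
Qed.

Lemma separating_comp_multiplier (A B : commBanachAlgType R[i])
  (T1 : {linear A -> B}) (T2 : {linear B -> B}) :
  tauberian B -> algebra_isomorphism T1 -> is_multiplier T2 -> separating (T2 \o T1).
Proof.
move=> tauB [_ T1M] mT2 a b ab; apply: (semisimple0 tauB) => y.
have [k yT2] := multiplier_gelfand y mT2.
by rewrite char_mul /= !yT2 mulrACA -char_mul -T1M ab !linear0 mulr0.
Qed.

Lemma separating_weights (A B : commBanachAlgType R[i]) (T : {linear A -> B}) :
  tauberian A -> condition_M A -> tauberian B -> separating T -> bijective T ->
  exists (h : character B -> character A) (w : character B -> R[i]^o),
    (forall y, w y != 0) /\ (forall (y : character B) (a : A), y (T a) = w y * h y a).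
Proof.
move=> tauA MA tauB sepT bijT.
have /choice[h /choice[w hw]] := separating_weighted_composition tauA MA tauB sepT bijT.
by exists h, w; split=> y; have [] := hw y.
Qed.

End Factorization.

Theorem theorem4p4 (R : realType) (A B : commBanachAlgType R[i])
  (tauA : tauberian A) (tauB : tauberian B)
  (bseA : BSE_algebra A) (bseB : BSE_algebra B)
  (MA : condition_M A) (MB : condition_M B)
  (aiA : has_1_bounded_approx_id A) (aiB : has_1_bounded_approx_id B)
  (T : {linear A -> B}) :
  (bijective T /\ separating T) <->
  exists (T1 : {linear A -> B}) (T2 : {linear B -> B}),
    [/\ algebra_isomorphism T1, is_multiplier T2, bijective T2 &
        forall a : A, T a = T2 (T1 a)].
Proof.
split=> [[bijT sepT]|[T1 [T2 [isoT1 mT2 bijT2 TE]]]]; last first.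
  split; first by apply: (eq_bij (bij_comp bijT2 isoT1.1)) => a; rewrite TE.
  by move=> a b /(separating_comp_multiplier tauB isoT1 mT2); rewrite /= -!TE.
have [S0 TS0 S0T] := bijT.
have [S SE] := inverse_linear TS0 S0T.
have TS : cancel T S by move=> a; rewrite SE TS0.
have ST : cancel S T by move=> b; rewrite SE S0T.
have bijS : bijective S by exists T.
have sepS : separating S := separating_inverse tauA MA tauB sepT bijT ST.
have [h [w [w0 hT]]] := separating_weights tauA MA tauB sepT bijT.
have [k [v [v0 kS]]] := separating_weights tauB MB tauA sepS bijS.
have [M M0 TM] := separating_bounded tauA MA tauB sepT bijT.
have [N N0 SN] := separating_bounded tauB MB tauA sepS bijS.
have [Sw mSw SwE] := weight_multiplier w0 hT MA aiA bseB M0 TM.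
have [Sv mSv SvE] := weight_multiplier v0 kS MB aiB bseA N0 SN.
(* [S] undoes [T], so [y] and [k (h y)] are proportional characters *)
have wv y : w y * v (h y) = 1.
  by apply: (@proportional_characters _ _ y (k (h y))) => b; rewrite -mulrA -kS -hT ST.
(* multiplying by [v] first removes the weight of [T] *)
pose T1 : {linear A -> B} := T \o Sv.
have T1E (y : character B) a : y (T1 a) = h y a.
  by rewrite /T1 /= hT SvE mulrA wv mul1r.
have T2T1 a : Sw (T1 a) = T a.
  by apply: (semisimple_eq tauB) => y; rewrite SwE T1E hT.
(* with [T2T1], this makes both [T1] and [Sw] bijective *)
have T1T2 b : T1 (S (Sw b)) = b.
  apply: (semisimple_eq tauB) => y.
  have e : w y * h y (S (Sw b)) = w y * y b by rewrite -hT ST SwE.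
  by rewrite T1E; apply: (mulfI (w0 y)).
exists T1, Sw; split=> //.
- split; last first.
    by move=> a b; apply: (semisimple_eq tauB) => y; rewrite char_mul !T1E char_mul.
  exists (S \o Sw) => [a|b]; last exact: T1T2.
  by rewrite /comp T2T1 TS.
- by exists (T1 \o S) => b; rewrite /comp ?T1T2 // T2T1 ST.
Qed.
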